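(* The inverse Lamperti transformation $L^{-1}:D\to D$ is continuous on the metric space $(D,d_\infty)$.
   Context: $E=[0,\infty]$, with any metric $\rho$ which makes $E$ homeomorphic to $[0,1]$. The space $D$. $D$ is the set of càdlàg functions $f:E\to E$ (so that $f(\infty-):=\lim_{t\to\infty}f(t)$ exists in $E$) such that $f(\infty-)=f(\infty)\in\{0,\infty\}$ and such that $f(t)=0$ (resp. $f(t)=\infty$) implies $f(t+s)=0$ (resp. $f(t+s)=\infty$) for all $s\ge 0$. Lamperti transformation. For $f\in D$ put $\theta_t:=\int_0^t f(s)\,ds\in[0,\infty]$ and $\kappa_t:=\inf\{u\ge 0:\theta_u>t\}\in[0,\infty]$ (with $\inf\emptyset=\infty$), and define $L(f)=f\circ\kappa$, so that $L(f)(t)=f(\infty)$ if $\kappa_t=\infty$. $L$ is a bijection of $D$ onto itself, and its inverse is described as follows: for $g\in D$ set $\kappa_t:=\int_0^t\frac{ds}{g(s)}\in[0,\infty]$ and let $\theta_t:=\inf\{u\ge 0:\kappa_u>t\}$ be its right-inverse; then $L^{-1}(g)=g\circ\theta$. The metric $d_\infty$. Let $\rho^D_\infty(f,g):=\sup_{s\in[0,\infty]}\rho(f(s),g(s))$, let $\Lambda_\infty$ be the set of increasing homeomorphisms of $[0,\infty)$ onto itself (extended by $\lambda(\infty)=\infty$), and let $\|\cdot\|_\infty$ be the uniform norm on $[0,\infty)$. Then $$d_\infty(f,g):=1\wedge\inf_{\lambda\in\Lambda_\infty}\Big(\rho^D_\infty(f,g\circ\lambda)\vee\|\lambda-\ma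thrm{Id}\|_\infty\Big).$$
   Formalization: D is restricted to functions for which f(t-)=0 with 0<t<∞ implies f(t)=0; without this, the inverse Lamperti transformation need not map D to D and is discontinuous, e.g. at g = sqrt(1-t) on [0,1), 1 on [1,2), ∞ afterwards. *)

(* Defs.v *)
(* MathComp-Analysis.  The space E = [0, +oo] is the subset [E] of \bar R, with
   the topology of \bar R.  A function E -> E is represented by a total function
   \bar R -> \bar R mapping [E] into [E]; its values outside [E] play no role in
   any of the definitions below. *)
From HB Require Import structures.
From mathcomp Require Import all_boot all_order all_algebra.
From mathcomp Require Import all_classical all_reals all_analysis.

Set Implicit Arguments.
Unset Strict Implicit.
Unset Printing Implicit Defensive.

Import Order.TTheory GRing.Theory Num.Theory.
Import numFieldNormedType.Exports.

Local Open Scope classical_set_scope.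
Local Open Scope ring_scope.
Local Open Scope ereal_scope.

Section Defs.
Context {R : realType}.

Definition E : set (\bar R) := [set x | 0 <= x].

Definition metric_on_E (rho : \bar R -> \bar R -> R) : Prop :=
  [/\ forall x y, E x -> E y -> (0 <= rho x y)%R,
      forall x y, E x -> E y -> (rho x y = 0%R <-> x = y),
      forall x y, E x -> E y -> rho x y = rho y x &
      forall x y z, E x -> E y -> E z -> (rho x z <= rho x y + rho y z)%R].

(* The rho-balls generate the usual topology of [0, +oo], i.e. that of [0, 1]. *)
Definition compatible_on_E (rho : \bar R -> \bar R -> R) : Prop :=
  forall x (U : set (\bar R)), E x ->
    (within E (nbhs x) U <->
     exists2 e : R, (0 < e)%R & forall y, E y -> (rho x y < e)%R -> U y).

(* Limits are taken in \bar R, so infinite limits are allowed; a left limit is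
   automatically in E, which is closed.  The limit at +oo is a field of [D]. *)
Definition cadlag (f : \bar R -> \bar R) : Prop :=
  (forall t : R, (0 <= t)%R -> f r%:E @[r --> t^'+] --> f t%:E) /\
  (forall t : R, (0 < t)%R -> exists l : \bar R, f r%:E @[r --> t^'-] --> l).

(* [D_left0] makes 0 absorbing for left limits too: a path creeping down to 0
   cannot jump away from it.  If it is dropped, the inverse Lamperti
   transformation is not continuous.  Take g(t) = sqrt (1 - t) on [0, 1[, 1 on
   [1, 2[ and +oo on [2, +oo], and let g_n be g with its values on [1 - 1/n, 1[
   replaced by n^-2.  Then g_n tends to g uniformly, but the inverse transform
   of g is +oo on [3, +oo], while that of g_n is n^-2 on [2, n[.
   No such condition at +oo is needed, hence none is imposed. *)
Record D (f : \bar R -> \bar R) : Prop := {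
  D_range : forall t, E t -> E (f t);
  D_cadlag : cadlag f;
  D_limit : f r%:E @[r --> +oo%R] --> f +oo;
  D_end : f +oo = 0 \/ f +oo = +oo;
  D_abs0 : forall t s, E t -> E s -> f t = 0 -> f (t + s) = 0;
  D_absoo : forall t s, E t -> E s -> f t = +oo -> f (t + s) = +oo;
  D_left0 : forall t : R, (0 < t)%R ->
    f r%:E @[r --> t^'-] --> (0 : \bar R) -> f t%:E = 0 }.

Definition primitive (f : \bar R -> \bar R) (t : \bar R) : \bar R :=
  \int[@lebesgue_measure R]_(s in [set s : R | (0 <= s)%R /\ s%:E <= t]) f s%:E.

(* [ereal_inf set0] is +oo. *)
Definition right_inv (k : \bar R -> \bar R) (t : \bar R) : \bar R :=
  ereal_inf [set u | E u /\ t < k u].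

(* The explicit inverse of the Lamperti transformation, which maps f to
   f \o right_inv (primitive f).  In \bar R, 0^-1 = +oo and +oo^-1 = 0. *)
Definition lamperti_inv (g : \bar R -> \bar R) : \bar R -> \bar R :=
  g \o right_inv (primitive (fun s => (g s)^-1)).

Definition increasing_homeo (lambda : R -> R) : Prop :=
  {in `[0%R, +oo[ &, {homo lambda : x y / (x < y)%R}} /\
  exists mu : R -> R,
    [/\ set_fun `[0%R, +oo[ `[0%R, +oo[ lambda,
        set_fun `[0%R, +oo[ `[0%R, +oo[ mu,
        {in `[0%R, +oo[, cancel lambda mu},
        {in `[0%R, +oo[, cancel mu lambda} &
        {within `[0%R, +oo[, continuous lambda} /\
        {within `[0%R, +oo[, continuous mu}].

Definition extend (lambda : R -> R) (x : \bar R) : \bar R :=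
  if x is r%:E then (lambda r)%:E else x.

Definition rhoD (rho : \bar R -> \bar R -> R) (f g : \bar R -> \bar R) : \bar R :=
  ereal_sup [set (rho (f s) (g s))%:E | s in E].

Definition dist_id (lambda : R -> R) : \bar R :=
  ereal_sup [set `|lambda s - s|%:E | s in `[0%R, +oo[].

Definition d_infty (rho : \bar R -> \bar R -> R) (f g : \bar R -> \bar R) : \bar R :=
  mine 1 (ereal_inf
    [set maxe (rhoD rho f (g \o extend lambda)) (dist_id lambda)
      | lambda in increasing_homeo]).

Definition continuous_on_metric (T : Type) (A : set T) (d : T -> T -> \bar R)
    (F : T -> T) : Prop :=
  forall x, A x -> forall e : R, (0 < e)%R -> exists2 delta : R, (0 < delta)%R &
    forall y, A y -> d x y < delta%:E -> d (F x) (F y) < e%:E.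

End Defs.

(* Main.v *)
(* The time change of g is the right inverse of the clock t |-> int_0^t ds/g(s).
   Fix g and let a = g(oo), which is 0 or oo.  Choose the first time t0 after
   which g stays e-close to a.  Before t0 the path g and its left limits avoid 0,
   and from any time before t0 on, g is again at a fixed distance from oo by time
   t0, so that a path close to g cannot have been absorbed at oo.  If y is close to g, say
   y o lam ~ g, then the clock of y at lam(s) is uniformly close to the clock of
   g at s for s <= t0: by real induction on the right end of the interval, since
   g and y o lam both stay in a small ball on each piece of a partition.  Hence
   K_y o lam o K^-1 is a time change close to the identity, where K and K_y are
   the clocks run up to t0 and lam(t0) and then continued with slope 1.  Before
   time K(t0) it carries the transform of g to that of y exactly as lam carries g
   to y, and after K(t0) both transforms only take values close to a. *)
Require Import Defs.
From mathcomp Require Import all_boot all_order all_algebra.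
From mathcomp Require Import all_classical all_reals all_analysis.
From mathcomp Require Import measurable_realfun.
From mathcomp Require Import ring lra.

Set Implicit Arguments.
Unset Strict Implicit.
Unset Printing Implicit Defensive.

Import Order.TTheory GRing.Theory Num.Theory.
Import numFieldNormedType.Exports.

Local Open Scope classical_set_scope.
Local Open Scope ring_scope.
Local Open Scope ereal_scope.

(** * Left limits and right continuity of paths *)

(** Allowing [l = +oo] gives one notion for left limits at finite times and for the limit at
    infinity. *)
Definition left_limit (R : realType) (g : \bar R -> \bar R) (l v : \bar R) :=
  forall U, nbhs v U -> exists2 a : R, (0 <= a)%R /\ a%:E < l &
    forall u : R, (a <= u)%R -> u%:E < l -> U (g u%:E).

Lemma left_limit_unique (R : realType) (g : \bar R -> \bar R) l v w :
  left_limit g l v -> left_limit g l w -> v = w.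
Proof.
move=> hv hw; apply: (@ereal_hausdorff R) => A B /hv[a [a0 al] ha] /hw[b [b0 bl] hb].
have mx : (Num.max a b)%:E < l by rewrite /Num.max; case: ifP.
by exists (g (Num.max a b)%:E); split; [apply: ha|apply: hb]; rewrite // le_max lexx ?orbT.
Qed.

Lemma left_limit_at_left (R : realType) (g : \bar R -> \bar R) (t : R) v :
  (0 < t)%R -> left_limit g t%:E v <-> g r%:E @[r --> t^'-] --> v.
Proof.
move=> t0; split => [h U /h[a [a0]]|h U /h].
  rewrite lte_fin => at_ H.
  have : \forall y \near t^'-, (a < y)%R by exact: nbhs_left_gt.
  move=> Ha; rewrite /nbhs/=; near=> y; apply: H; rewrite ?lte_fin; near: y => //.
    by apply: filterS Ha => y /ltW.
  exact: nbhs_left_lt.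
rewrite /nbhs/= /at_left => /nbhs_ballP[e /= e0 H].
exists (Num.max 0 (t - e / 2))%R.
  rewrite le_max lexx; split=> //; rewrite lte_fin gt_max t0/=.
  by rewrite ltrBlDr ltrDl divr_gt0.
move=> u; rewrite ge_max lte_fin => /andP[u0 ut] ult; apply: H => //.
rewrite /ball/= ger0_norm ?subr_ge0 ?(ltW ult)//; lra.
Unshelve. all: by end_near. Qed.

Lemma left_limit_pinfty (R : realType) (g : \bar R -> \bar R) v :
  left_limit g +oo v <-> g r%:E @[r --> +oo%R] --> v.
Proof.
split => [h U /h[a [a0 _] H]|h U /h].
  by rewrite /nbhs/=; exists a; split; [exact: num_real|move=> u /ltW au; apply: H; rewrite ?ltry].
rewrite /nbhs/= => -[M [_ H]]; exists (Num.max 0 (M + 1))%R.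
  by rewrite ltry le_max lexx.
by move=> u; rewrite ge_max => /andP[u0 Mu] _; apply: H; lra.
Qed.

Lemma right_continuousP (R : realType) (g : \bar R -> \bar R) (t : R) :
  g r%:E @[r --> t^'+] --> g t%:E <->
  forall U, nbhs (g t%:E) U ->
    exists2 e : R, (0 < e)%R & forall s, (t <= s)%R -> (s < t + e)%R -> U (g s%:E).
Proof.
split=> [h U gU|h U /h[e e0 H]].
  have := h U gU; rewrite /nbhs/= /at_right => /nbhs_ballP[e /= e0 H].
  exists e => // s; rewrite le_eqVlt => /predU1P[<- _|ts se].
    exact: nbhs_singleton.
  apply: H => //; rewrite /ball/= distrC ger0_norm; lra.
rewrite /nbhs/= /at_right; apply/nbhs_ballP; exists e => //= y.
rewrite /ball/= distrC => ye ty; apply: H; first exact: ltW.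
have := ler_norm (y - t); lra.
Qed.

Lemma D_right_continuous (R : realType) (g : \bar R -> \bar R) (t : R) U :
  D g -> (0 <= t)%R -> nbhs (g t%:E) U ->
  exists2 e : R, (0 < e)%R & forall s, (t <= s)%R -> (s < t + e)%R -> U (g s%:E).
Proof.
by move=> Dg t0; exact: ((right_continuousP g t).1 ((D_cadlag Dg).1 t t0)).
Qed.

(** For finite [l] this collects [D_cadlag] and [D_left0], for [l = +oo] it is [D_limit]. The limit
    stays in [E] because the negative values form an open set. *)
Lemma D_left_limit (R : realType) (g : \bar R -> \bar R) (l : \bar R) :
  D g -> 0 < l ->
  exists v, [/\ E v, left_limit g l v, (v = 0 -> g l = 0) & (l = +oo -> v = g l)].
Proof.
move=> Dg; have Eg v : left_limit g l v -> E v.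
  move=> hv; rewrite /E/= leNgt; apply/negP => v0.
  have [|a [a0 al] H] := hv [set y | y < 0].
    by have := @open_ereal_lt' R _ _ v0.
  by have := H a (lexx _) al; rewrite /= ltNge (D_range Dg).
case: l Eg => [t| |//] Eg l0; last first.
  exists (g +oo); have h := (@left_limit_pinfty R g (g +oo)).2 (D_limit Dg).
  by split=> //; exact: Eg.
have [v hv] := (D_cadlag Dg).2 t l0.
have lv := (@left_limit_at_left R g t v l0).2 hv.
exists v; split => //; first exact: Eg.
by move=> v0; rewrite v0 in hv; exact: (D_left0 Dg l0 hv).
Qed.

(** Inversion is continuous on ]0, +oo]. The bounds are real even at [a = +oo], where 1/y is near 0,
    so that they can serve as slopes of the clock. *)
Lemma nbhs_inve (R : realType) (a : \bar R) (eps : R) : E a -> a != 0 -> (0 < eps)%R ->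
  exists c1 c2 : R, [/\ (0 <= c1)%R, (c1 <= c2)%R, (c2 - c1 <= eps)%R &
    nbhs a [set y | c1%:E <= y^-1 <= c2%:E]].
Proof.
rewrite /E/=; case: a => [r| |//]; last first.
  move=> _ _ e0; exists 0%R, eps; split => //; [exact: ltW|by rewrite subr0|].
  apply: filterS (@nbhs_open_ereal_pinfty R (eps^-1)) => y /= ey.
  have y0 : 0 <= y by apply: le_trans (ltW ey); rewrite lee_fin invr_ge0 ltW.
  rewrite inve_ge0 y0/= inve_ple ?inE//; last by rewrite lee_fin ltW.
  by rewrite inver gt_eqF// ltW.
move=> r0; rewrite eqe => rn0 e0; rewrite lee_fin in r0; have rp : (0 < r)%R by rewrite lt_neqAle eq_sym rn0.
pose x := (r^-1)%R; have x0 : (0 < x)%R by rewrite invr_gt0.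
(* At most eps/2 for the width of [x - m, x + m], and at most x/2 to keep both ends positive. *)
pose m := (Num.min (eps / 2) (x / 2))%R.
have m0 : (0 < m)%R by rewrite lt_min !divr_gt0.
have me : (m <= eps / 2)%R by rewrite ge_min lexx.
have mx : (m <= x / 2)%R by rewrite ge_min lexx orbT.
have c1 : (0 < x - m)%R by lra.
have c2 : (0 < x + m)%R by lra.
exists (x - m)%R, (x + m)%R; split => //; [lra..|].
have h1 : ((x + m)^-1)%:E < r%:E by rewrite lte_fin -[ltRHS]invrK ltf_pV2 ?posrE//; rewrite /x in x0 *; lra.
have h2 : r%:E < ((x - m)^-1)%:E by rewrite lte_fin -[ltLHS]invrK ltf_pV2 ?posrE//; rewrite /x in x0 *; lra.
apply: filterS2 (open_ereal_gt' h1) (open_ereal_lt' h2) => y y1 y2 /=.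
have y0 : 0 <= y by apply: le_trans (ltW y1); rewrite lee_fin invr_ge0 ltW.
rewrite inve_pge ?inE ?lee_fin ?(ltW c1)// inve_ple ?inE ?lee_fin ?(ltW c2)//.
by rewrite !inver !gt_eqF// (ltW y1) (ltW y2).
Qed.

(** * The clock of a path: measurability, growth and finiteness *)

Definition clock (R : realType) (g : \bar R -> \bar R) : \bar R -> \bar R :=
  primitive (fun s => (g s)^-1).

(* [U] is the union over rationals [q] of the intervals of those [s <= q] with
   [[s, q]] contained in [U]. *)
Lemma measurable_right_open (R : realType) (U : set R) :
  (forall s, U s -> exists2 e : R, (0 < e)%R &
    forall u, (s <= u)%R -> (u < s + e)%R -> U u) -> measurable U.
Proof.
move=> hU.
have -> : U = \bigcup_(q : rat) [set s | (s <= ratr q)%R /\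
    forall u, (s <= u)%R -> (u <= ratr q)%R -> U u].
  apply/seteqP; split => [s Us|s [q _ [sq H]]]; last exact: H.
  have [e e0 He] := hU s Us.
  have [q /itvP hq] := @rat_in_itvoo R s (s + e) (ltac:(lra)).
  exists q => //; split => [|u su uq]; first by rewrite ltW// hq.
  by apply: He => //; apply: le_lt_trans uq _; rewrite hq.
apply: bigcupT_measurable_rat => q; apply: is_interval_measurable.
move=> x y [xq Hx] [yq Hy] z /andP[xz zy]; split; first exact: le_trans zy yq.
by move=> u zu uq; apply: Hx => //; exact: le_trans xz zu.
Qed.

(** By right continuity of [g], the sets where 1/g < r satisfy the condition of
    [measurable_right_open]. *)
Lemma measurable_inve_D (R : realType) (g : \bar R -> \bar R) (A : set R) :
  D g -> measurable A -> A `<=` [set s | (0 <= s)%R] ->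
  measurable_fun A (fun s => (g s%:E)^-1).
Proof.
move=> Dg mA A0.
suff mg : measurable_fun (`[0%R, +oo[%classic : set R) (fun s : R => (g s%:E)^-1).
  by apply: measurable_funS mg => // x /A0 /= x0; rewrite in_itv/= x0.
move=> mD; apply: (measurability _ (ErealGenInftyO.measurableE R)) => //.
move=> _ [_ [r ->] <-]; apply: measurable_right_open => s /=.
rewrite !in_itv/= andbT => -[s0 sr].
have Egs : E (g s%:E) by apply: (D_range Dg); rewrite /E/= lee_fin.
have r0 : 0 <= r%:E by apply: le_trans (ltW sr); rewrite inve_ge0.
have gs : r%:E^-1 < g s%:E by rewrite -inve_plt ?inE.
have [e e0 He] := D_right_continuous Dg s0 (open_ereal_gt' gs).
exists e => // u su use; have u0 : (0 <= u)%R by exact: le_trans su.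
split; first by rewrite in_itv/= u0.
have Egu : E (g u%:E) by apply: (D_range Dg); rewrite /E/= lee_fin.
by rewrite /= in_itv/= inve_plt ?inE//; exact: He.
Qed.

Lemma inve_D_ge0 (R : realType) (g : \bar R -> \bar R) (s : R) :
  D g -> (0 <= s)%R -> 0 <= (g s%:E)^-1.
Proof. by move=> Dg s0; rewrite inve_ge0; apply: (D_range Dg); rewrite /E/= lee_fin. Qed.

Lemma clock_fin (R : realType) (g : \bar R -> \bar R) (t : R) :
  clock g t%:E = \int[lebesgue_measure]_(s in `[0%R, t]) (g s%:E)^-1.
Proof.
by rewrite /clock /primitive; congr integral; apply/seteqP; split => s /=;
  rewrite in_itv/= lee_fin => /andP.
Qed.

(** Dropping the null set {t} leaves the open interval, so that later bounds only involve values of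
    [g] strictly between [s] and [t]. *)
Lemma clock_add (R : realType) (g : \bar R -> \bar R) (s t : R) :
  D g -> (0 <= s)%R -> (s <= t)%R ->
  clock g t%:E = clock g s%:E +
    \int[lebesgue_measure]_(u in `]s, t[) (g u%:E)^-1.
Proof.
move=> Dg s0 st; rewrite !clock_fin.
rewrite -(@integral_itv_bndoo _ s t _ false false); last first.
  apply: measurable_inve_D => // u /=; rewrite in_itv/= => /andP[/ltW su _].
  exact: le_trans su.
have -> : `[0%R, t]%classic = `[0%R, s]%classic `|` `]s, t]%classic.
  by rewrite -itv_bndbnd_setU// ?bnd_simp.
rewrite ge0_integral_setU//=.
- apply: measurable_inve_D => //; first exact: measurableU.
  by move=> u /= [|]; rewrite in_itv/= => /andP[]// /ltW su _; exact: le_trans su.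
- move=> u; rewrite !in_itv/= => -[/andP[u0 _]|/andP[/ltW su _]]; apply: inve_D_ge0 => //.
  exact: le_trans su.
- by apply/disj_setPLR => u /=; rewrite !in_itv/= => /andP[_ us] /andP[]; rewrite ltNge us.
Qed.

Lemma clock_ge0 (R : realType) (g : \bar R -> \bar R) t : D g -> 0 <= clock g t.
Proof. by move=> Dg; apply: integral_ge0 => s [s0 _]; exact: inve_D_ge0. Qed.

Lemma clock0 (R : realType) (g : \bar R -> \bar R) : clock g 0 = 0.
Proof. by rewrite clock_fin set_itv1 integral_set1. Qed.

Lemma clock_le (R : realType) (g : \bar R -> \bar R) s t :
  D g -> s <= t -> clock g s <= clock g t.
Proof.
have meas (w : \bar R) : measurable [set s : R | (0 <= s)%R /\ s%:E <= w].
  apply: is_interval_measurable => x y [x0 _] [_ yw] z /andP[xz zy]; split.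
    exact: le_trans xz.
  by apply: le_trans yw; rewrite lee_fin.
move=> Dg st; apply: ge0_subset_integral => //=.
- exact: meas.
- exact: meas.
- by apply: measurable_inve_D => // u [].
- by move=> u [u0 _]; exact: inve_D_ge0.
- by move=> u [u0 us]; split => //; exact: le_trans st.
Qed.

Lemma integral_cst_itvoo (R : realType) (s t c : R) : (s <= t)%R ->
  \int[@lebesgue_measure R]_(u in `]s, t[) c%:E = (c * (t - s))%:E.
Proof.
move=> st; rewrite integral_cst//= lebesgue_measure_itv/= lte_fin.
by case: ltgtP st => // -> _; rewrite subrr mulr0 mule0.
Qed.

Lemma clock_lower_bound (R : realType) (g : \bar R -> \bar R) (s t c : R) :
  D g -> (0 <= s)%R -> (s <= t)%R -> (0 <= c)%R ->
  (forall u, (s < u)%R -> (u < t)%R -> c%:E <= (g u%:E)^-1) ->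
  clock g s%:E + (c * (t - s))%:E <= clock g t%:E.
Proof.
move=> Dg s0 st c0 H; rewrite (clock_add Dg s0 st) leeD2l// -integral_cst_itvoo//.
apply: ge0_le_integral => //=; last by move=> u; rewrite in_itv/= => /andP[]; exact: H.
apply: measurable_inve_D => // u /=; rewrite in_itv/= => /andP[/ltW su _].
exact: le_trans su.
Qed.

Lemma clock_upper_bound (R : realType) (g : \bar R -> \bar R) (s t c : R) :
  D g -> (0 <= s)%R -> (s <= t)%R ->
  (forall u, (s < u)%R -> (u < t)%R -> (g u%:E)^-1 <= c%:E) ->
  clock g t%:E <= clock g s%:E + (c * (t - s))%:E.
Proof.
move=> Dg s0 st H; rewrite (clock_add Dg s0 st) leeD2l// -integral_cst_itvoo//.
have st0 u : u \in `]s, t[ -> (0 <= u)%R.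
  by rewrite in_itv/= => /andP[/ltW su _]; exact: le_trans su.
apply: ge0_le_integral => //=.
- by move=> u /st0; exact: inve_D_ge0.
- exact: measurable_inve_D.
- by move=> u; rewrite in_itv/= => /andP[]; exact: H.
Qed.

(** Monotone convergence along the intervals [0, a n], whose union is [0, l[; for finite [l] the
    endpoint is a null set. *)
Lemma clock_exhaust (R : realType) (g : \bar R -> \bar R) (l x : \bar R) (a : nat -> R) :
  D g -> nondecreasing_seq a -> (forall n, (a n)%:E < l) ->
  (forall s : R, s%:E < l -> exists n, (s <= a n)%R) ->
  x < clock g l -> exists n, x < clock g (a n)%:E.
Proof.
move=> Dg nda al H.
pose F n := [set s : R | (0 <= s)%R /\ s%:E <= (a n)%:E].
have mF n : measurable (F n).
  apply: is_interval_measurable => y z [y0 _] [_ zw] w /andP[yw wz]; split.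
    exact: le_trans yw.
  by apply: le_trans zw; rewrite lee_fin.
have mf n : measurable_fun (F n) (fun s : R => (g s%:E)^-1).
  by apply: measurable_inve_D => // u [].
have F0 n s : F n s -> 0 <= (g s%:E)^-1 by case=> s0 _; exact: inve_D_ge0.
have ndF : nondecreasing_seq F.
  move=> m n mn; apply/subsetPset => s [s0 sm]; split => //; apply: le_trans sm _.
  by rewrite lee_fin nda.
have UF : \bigcup_n F n = [set s : R | (0 <= s)%R /\ s%:E < l].
  apply/seteqP; split => [s [n _ [s0 sn]]|s [s0 sl]].
    by split => //; exact: le_lt_trans (al n).
  by have [n sn] := H s sl; exists n => //; split.
have <- : \int[@lebesgue_measure R]_(s in \bigcup_n F n) (g s%:E)^-1 = clock g l.
  rewrite UF; case: l al H UF => [t| |] al H _; last by have := al 0%N.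
    rewrite clock_fin -integral_itv_bndo_bndc.
      by congr integral; apply/seteqP; split => s; rewrite /= in_itv/= lte_fin => /andP.
    by apply: measurable_inve_D => // s /=; rewrite in_itv/= => /andP[].
  rewrite /clock /primitive; congr integral; apply/seteqP; split => s [s0 _];
    by split; rewrite ?leey ?ltry.
move=> xl.
have := ge0_nondecreasing_set_cvg_integral (mu := @lebesgue_measure R) ndF mF mf F0.
by move=> /(_ _ (open_ereal_gt' xl)) [N _ /(_ N (leqnn N))] /= xN; exists N.
Qed.

(** Exhausts [0, l[ by the times l - 1/(n+1), or by the integers if [l = +oo]. Phrased with [x]
    below the clock, it also covers an infinite value at [l]. *)
Lemma clock_left_continuous (R : realType) (g : \bar R -> \bar R) (l x : \bar R) :
  D g -> 0 < l -> x < clock g l ->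
  exists u : R, [/\ (0 <= u)%R, u%:E < l & x < clock g u%:E].
Proof.
move=> Dg l0 xl.
suff [u ul xu] : exists2 u : R, u%:E < l & x < clock g u%:E.
  exists (Num.max 0 u)%R; split; first by rewrite le_max lexx.
  - by rewrite /Num.max; case: ifP.
  - by apply: lt_le_trans xu _; apply: clock_le => //; rewrite lee_fin le_max lexx orbT.
case: l l0 xl => [t| |//] l0 xl.
  have [| | |n xn] := @clock_exhaust R g t%:E x (fun n => t - n.+1%:R^-1)%R Dg _ _ _ xl.
  - by move=> m n mn; rewrite lerB// lef_pV2 ?posrE// ler_nat.
  - by move=> n; rewrite lte_fin ltrBlDr ltrDl invr_gt0.
  - move=> s; rewrite lte_fin => /ltr_add_invr[k sk]; exists k.
    by rewrite lerBrDr ltW.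
  - by exists (t - n.+1%:R^-1)%R; rewrite // lte_fin ltrBlDr ltrDl invr_gt0.
have [| | |n xn] := @clock_exhaust R g +oo x (fun n => n%:R)%R Dg _ _ _ xl.
- by move=> m n mn; rewrite ler_nat.
- by move=> n; rewrite ltry.
- move=> s _; exists (Num.truncn s).+1; exact/ltW/truncnS_gt.
- by exists n%:R%R; rewrite // ltry.
Qed.

Lemma D_absorbing0 (R : realType) (g : \bar R -> \bar R) l m :
  D g -> E l -> l <= m -> g l = 0 -> g m = 0.
Proof.
move=> Dg El lm gl; case: l El lm gl => [r| |//] El lm gl; last first.
  by move: lm; rewrite leye_eq => /eqP ->.
rewrite -(@subeK _ m r%:E)// addeC; apply: (D_abs0 Dg) => //.
by have : 0 <= m - r%:E by rewrite sube_ge0.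
Qed.

Lemma D_absorbingy (R : realType) (g : \bar R -> \bar R) l m :
  D g -> E l -> l <= m -> g l = +oo -> g m = +oo.
Proof.
move=> Dg El lm gl; case: l El lm gl => [r| |//] El lm gl; last first.
  by move: lm; rewrite leye_eq => /eqP ->.
rewrite -(@subeK _ m r%:E)// addeC; apply: (D_absoo Dg) => //.
by have : 0 <= m - r%:E by rewrite sube_ge0.
Qed.

(** Right continuity bounds 1/g just after a point where [g] is not 0. *)
Lemma clock_right_finite (R : realType) (g : \bar R -> \bar R) (s : R) :
  D g -> (0 <= s)%R -> g s%:E != 0 -> exists2 e : R, (0 < e)%R &
    exists2 c : R, (0 <= c)%R & forall t, (s <= t)%R -> (t <= s + e)%R ->
      clock g t%:E <= clock g s%:E + (c * (t - s))%:E.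
Proof.
move=> Dg s0 gs.
have Egs : E (g s%:E) by apply: (D_range Dg); rewrite /E/= lee_fin.
have [c1 [c2 [c10 c12 _ N]]] := nbhs_inve Egs gs ltr01.
have [e e0 H] := D_right_continuous Dg s0 N.
exists e => //; exists c2; first exact: le_trans c12.
move=> t st te; apply: clock_upper_bound => // u su ut.
by have /andP[] := H u (ltW su) (lt_le_trans ut te).
Qed.

(** A nonzero left limit bounds 1/g just before [l], so the clock cannot explode there. *)
Lemma clock_left_finite (R : realType) (g : \bar R -> \bar R) (l : R) v :
  D g -> (0 < l)%R -> E v -> left_limit g l%:E v -> v != 0 ->
  (forall t : R, (0 <= t)%R -> (t < l)%R -> clock g t%:E < +oo) -> clock g l%:E < +oo.
Proof.
move=> Dg l0 Ev hv v0 fin.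
have [c1 [c2 [c10 c12 _ N]]] := nbhs_inve Ev v0 ltr01.
have [a [a0]] := hv _ N; rewrite lte_fin => al H.
apply: le_lt_trans (_ : clock g a%:E + (c2 * (l - a))%:E < _).
  apply: clock_upper_bound => //; first exact: ltW.
  by move=> u au ul; have /andP[] := H u (ltW au) (ltac:(rewrite lte_fin//)).
by rewrite lte_add_pinfty ?fin// ltry.
Qed.

(** A finite value x of [g] at [s] keeps [g] below x + 1 just after [s], where the clock then has
    slope at least 1/(x + 1). *)
Lemma clock_lt (R : realType) (g : \bar R -> \bar R) (s t : R) :
  D g -> (0 <= s)%R -> (s < t)%R -> g s%:E != +oo -> clock g s%:E < +oo ->
  clock g s%:E < clock g t%:E.
Proof.
move=> Dg s0 st gs fin.
have gs0 : 0 <= g s%:E by apply: (D_range Dg); rewrite /E/= lee_fin.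
have [x gx] : exists x, g s%:E = x%:E by case: (g s%:E) gs gs0 => // r; exists r.
have x0 : (0 <= x)%R by rewrite -lee_fin -gx.
have gsx : g s%:E < (x + 1)%:E by rewrite gx lte_fin; lra.
have [e e0 H] := D_right_continuous Dg s0 (open_ereal_lt' gsx).
pose t' := Num.min t (s + e)%R.
have st' : (s < t')%R by rewrite lt_min st/=; lra.
have t't : t'%:E <= t%:E by rewrite lee_fin ge_min lexx.
apply: lt_le_trans (clock_le Dg t't).
have x1 : (0 < x + 1)%R by lra.
apply: lt_le_trans (@clock_lower_bound R g s t' (x + 1)^-1 Dg s0 (ltW st') _ _).
- rewrite lteDl; last by rewrite ge0_fin_numE ?clock_ge0.
  by rewrite lte_fin mulr_gt0 ?invr_gt0// subr_gt0.
- by rewrite invr_ge0 ltW.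
- move=> u su ut'; rewrite inve_pge ?inE.
  + rewrite inver gt_eqF ?invr_gt0// invrK; apply: ltW; apply: H; first exact: ltW.
    by apply: lt_le_trans ut' _; rewrite ge_min lexx orbT.
  + by rewrite lee_fin invr_ge0 ltW.
  + by apply: (D_range Dg); rewrite /E/= lee_fin (le_trans s0)// ltW.
Qed.

(** * Right inverses of nondecreasing functions *)

Section right_inv.
Context (R : realType) (k : \bar R -> \bar R).
Context (k_le : forall s t, s <= t -> k s <= k t).

Lemma right_inv_ge0 t : E (right_inv k t).
Proof. by apply: le_ereal_inf_tmp => u []. Qed.

Lemma right_inv_le t u : E u -> t < k u -> right_inv k t <= u.
Proof. by move=> Eu tu; apply: ereal_inf_lbound. Qed.

Lemma right_inv_lt t u : right_inv k t < u -> t < k u.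
Proof.
move=> /ereal_inf_lt[v [Ev tv] vu]; apply: lt_le_trans tv _; exact/k_le/ltW.
Qed.

Lemma right_inv_gt t u : E u -> u < right_inv k t -> k u <= t.
Proof. by move=> Eu; apply: contraTle => /(right_inv_le Eu); rewrite leNgt. Qed.

Lemma right_inv_homo s t : s <= t -> right_inv k s <= right_inv k t.
Proof.
move=> st; apply: le_ereal_inf_tmp => u [Eu tu]; apply: right_inv_le => //.
exact: le_lt_trans tu.
Qed.

Lemma right_inv_pinfty : right_inv k +oo = +oo.
Proof.
apply/eqP; rewrite -leye_eq; apply: le_ereal_inf_tmp => u [_].
by rewrite ltNge leey.
Qed.

(** Some u < x has t < k u, and this strict inequality survives a small increase of t. *)
Lemma right_inv_right_continuous (t : R) (x : \bar R) : right_inv k t%:E < x ->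
  exists2 e : R, (0 < e)%R & forall s, (s < t + e)%R -> right_inv k s%:E < x.
Proof.
move=> /ereal_inf_lt[u [Eu tu] ux].
have [e e0 H] : exists2 e : R, (0 < e)%R & forall s, (s < t + e)%R -> s%:E < k u.
  case: (k u) tu => [r| |//] tu.
    exists (r - t)%R; first by rewrite subr_gt0 -lte_fin.
    by move=> s; rewrite addrC subrK lte_fin.
  by exists 1%R => // s _; rewrite ltry.
by exists e => // s /H su; apply: le_lt_trans ux; exact: right_inv_le.
Qed.

End right_inv.

(** * The inverse transformation maps [D] into itself *)

(* Either [theta] is eventually constant to the left of [L], or it increases
   strictly to its left limit [l], and then [g \o theta] has the left limit [v]
   of [g] at [l]. *)
Lemma left_limit_comp (R : realType) (g theta : \bar R -> \bar R) (L : \bar R) :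
  D g -> (forall t, E (theta t)) -> (forall s t, s <= t -> theta s <= theta t) ->
  0 < L -> exists l v, [/\ E l /\ left_limit (g \o theta) L v,
    forall u : R, u%:E < L -> theta u%:E <= l,
    forall x, x < l -> exists u : R, [/\ (0 <= u)%R, u%:E < L & x < theta u%:E],
    v = 0 -> g l = 0 &
    v = g l \/ [/\ 0 < l, left_limit g l v, (l = +oo -> v = g l) &
                   forall u : R, u%:E < L -> theta u%:E < l]].
Proof.
move=> Dg Eth th_le L0.
pose S := [set theta u%:E | u in [set u : R | (0 <= u)%R /\ u%:E < L]].
pose l := ereal_sup S.
have S0 : S (theta 0) by exists 0%R => //; rewrite /= lexx L0.
have El : E l by apply: le_trans (Eth 0) _; exact: ereal_sup_ubound.
have th_ub u : u%:E < L -> theta u%:E <= l.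
  move=> uL; apply: le_trans (th_le _ ((Num.max 0 u)%R)%:E _) _.
    by rewrite lee_fin le_max lexx orbT.
  apply: ereal_sup_ubound; exists (Num.max 0 u)%R => //=; split.
    by rewrite le_max lexx.
  by rewrite /Num.max; case: ifP.
have supl x : x < l -> exists u : R, [/\ (0 <= u)%R, u%:E < L & x < theta u%:E].
  by move=> /ereal_sup_gt[_ [u [u0 uL] <-] xu]; exists u.
have [[a [[a0 aL] tha]]|nS] := pselect (exists a : R, ((0 <= a)%R /\ a%:E < L) /\ theta a%:E = l).
  exists l, (g l); split => //; last by left.
  split => // U gU; exists a => // u au uL /=.
  suff -> : theta u%:E = l by exact: nbhs_singleton.
  by apply/eqP; rewrite eq_le th_ub//= -tha th_le// lee_fin.
have th_lt u : u%:E < L -> theta u%:E < l.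
  move=> uL; rewrite lt_neqAle th_ub// andbT; apply/eqP => thu; apply: nS.
  exists (Num.max 0 u)%R; split.
    split; first by rewrite le_max lexx.
    by rewrite /Num.max; case: ifP.
  apply/eqP; rewrite eq_le th_ub/=; last by rewrite /Num.max; case: ifP.
  by rewrite -thu th_le// lee_fin le_max lexx orbT.
have l0 : 0 < l by apply: le_lt_trans (Eth 0) (th_lt _ L0).
have [v [Ev hv v0 vy]] := D_left_limit Dg l0.
exists l, v; split => //; last by right.
split => // U /hv[a [a0 al] H]; have [b [b0 bL ab]] := supl _ al.
exists b => // u bu uL /=.
have : a%:E < theta u%:E by apply: lt_le_trans ab _; apply: th_le; rewrite lee_fin.
have := th_lt _ uL.
case: (theta u%:E) => [r| |] // rl ar; last by move: rl; rewrite ltNge leey.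
by apply: H => //; rewrite lte_fin in ar; exact: ltW.
Qed.

Lemma lamperti_invE (R : realType) (g : \bar R -> \bar R) :
  lamperti_inv g = g \o right_inv (clock g).
Proof. by []. Qed.

(** If [g x] were not 0, the clock would still be finite at some x + e, and its right inverse at
    that clock value would be at least x + e, beyond the bound x. *)
Lemma D_right_inv_bounded (R : realType) (g : \bar R -> \bar R) (x : R) :
  D g -> (0 <= x)%R ->
  (forall u : R, right_inv (clock g) u%:E <= x%:E) ->
  (forall y, y < x%:E -> exists u : R, [/\ (0 <= u)%R, u%:E < +oo &
      y < right_inv (clock g) u%:E]) ->
  g x%:E = 0.
Proof.
move=> Dg x0 th_le th_sup; apply: contrapT => gx.
have kle := fun s t => @clock_le R g s t Dg.
(* Each t < x lies below some value of the right inverse at a real u, which bounds the clock at t by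
   u. The left limit of [g] at x is not 0, as [g x] is not, so the clock stays finite up to x. *)
have kfin : clock g x%:E < +oo.
  have [x00|xn0] := eqVneq x 0%R; first by rewrite x00 clock0 ltry.
  have xp : 0 < x%:E by rewrite lte_fin lt_neqAle eq_sym xn0.
  have [v [Ev hv v0 _]] := D_left_limit Dg xp.
  apply: (clock_left_finite Dg _ Ev hv) => //; first by apply/eqP => /v0.
  move=> t t0 tx; have [|u [u0 _ tu]] := th_sup t%:E; first by rewrite lte_fin.
  by apply: le_lt_trans (right_inv_gt _ tu) (ltry u).
have [e e0 [c c0 H]] := clock_right_finite Dg x0 (introN eqP gx).
have kfin' : clock g (x + e)%:E < +oo.
  apply: le_lt_trans (H _ _ _) _; [lra|exact: lexx|].
  exact: lte_add_pinfty kfin (ltry _).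
have kf : clock g (x + e)%:E \is a fin_num by rewrite ge0_fin_numE// clock_ge0.
have : right_inv (clock g) (fine (clock g (x + e)%:E))%:E < (x + e)%:E.
  by apply: le_lt_trans (th_le _) _; rewrite lte_fin; lra.
by move=> /(right_inv_lt kle); rewrite fineK// ltxx.
Qed.

(** Since [theta] is nondecreasing and right-continuous, [g \o theta] inherits right continuity,
    left limits and absorption. The delicate point is the limit at infinity when [theta] stays
    bounded. *)
Lemma D_lamperti_inv (R : realType) (g : \bar R -> \bar R) : D g -> D (lamperti_inv g).
Proof.
move=> Dg; rewrite lamperti_invE; set theta := right_inv _.
have kle := fun s t => @clock_le R g s t Dg.
have Eth t : E (theta t) by exact: right_inv_ge0.
have th_le : forall s t, s <= t -> theta s <= theta t by exact: right_inv_homo.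
have thy : theta +oo = +oo by exact: right_inv_pinfty.
have EDs (t s : \bar R) : E t -> E s -> t <= t + s.
  by move=> _ Es; exact: leeDl.
split.
- by move=> t _; exact: (D_range Dg).
- split => t t0.
    apply/right_continuousP => U /= gU.
    case tht : (theta t%:E) gU (Eth t%:E) => [x| |//] gU Ex; last first.
      exists 1%R => // s ts _; have := th_le t%:E s%:E.
      rewrite lee_fin tht leye_eq => /(_ ts)/eqP ->.
      exact: nbhs_singleton.
    rewrite /E/= lee_fin in Ex.
    have [e e0 He] := D_right_continuous Dg Ex gU.
    have thx : theta t%:E < (x + e)%:E by rewrite tht lte_fin; lra.
    have [e' e'0 He'] := right_inv_right_continuous thx.
    exists e' => // s ts /He'; have := th_le t%:E s%:E.
    rewrite lee_fin tht => /(_ ts); rewrite -/(theta _).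
    case: (theta s%:E) => [y| |] //.
    by rewrite lee_fin lte_fin; exact: He.
  have t0' : 0 < t%:E by rewrite lte_fin.
  have [l [v [[_ hv] _ _ _ _]]] := left_limit_comp Dg Eth th_le t0'.
  by exists v; apply/left_limit_at_left.
- have [l [v [[El hv] ub sup v0 vl]]] := left_limit_comp Dg Eth th_le (@lt0y R).
  apply/left_limit_pinfty; rewrite /= thy.
  suff <- : v = g +oo by [].
  case: l El ub sup v0 vl => [x| |//] El ub sup v0 vl; last first.
    by case: vl => [//|[_ _ /(_ erefl)]].
  rewrite /E/= lee_fin in El.
  (* Here [theta] has a finite supremum x, so [g] is absorbed at 0 by time x. *)
  have gx : g x%:E = 0 by apply: D_right_inv_bounded => // u; exact/ub/ltry.
  have gy : g +oo = 0 by apply: (D_absorbing0 Dg _ _ gx) => //; rewrite ?leey// /E/= lee_fin.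
  (* If the limit is [g x], it is 0. Otherwise [theta] stays below x and the limit is the left limit
     of [g] at x; were this not 0, the clock would be finite at x and [theta] would reach x at that
     clock value. *)
  rewrite gy; case: vl => [->//|[xp lv _ lt]]; apply: contrapT => vn0.
  have [w [Ew hw _ _]] := D_left_limit Dg xp.
  rewrite (left_limit_unique lv hw) in vn0.
  have kfin : clock g x%:E < +oo.
    apply: (clock_left_finite Dg xp Ew hw); first exact/eqP.
    move=> t t0 tx; have [|u [u0 _ tu]] := sup t%:E; first by rewrite lte_fin.
    by apply: le_lt_trans (right_inv_gt _ tu) (ltry u).
  have kf : clock g x%:E \is a fin_num by rewrite ge0_fin_numE// clock_ge0.
  have := lt (fine (clock g x%:E)) (ltry _).
  by move=> /(right_inv_lt kle); rewrite fineK// ltxx.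
- by rewrite /= thy; exact: (D_end Dg).
- move=> t s Et Es /= g0; apply: (D_absorbing0 Dg _ _ g0) => //.
  exact/th_le/EDs.
- move=> t s Et Es /= g0; apply: (D_absorbingy Dg _ _ g0) => //.
  exact/th_le/EDs.
(* A left limit 0 forces [g l = 0], where [l] bounds [theta] before [t]; as [theta t] is at least
   [l], absorption concludes. *)
- move=> t t0 /(left_limit_at_left _ _ t0) h0 /=.
  have t0' : 0 < t%:E by rewrite lte_fin.
  have [l [v [[El hv] ub sup v0 _]]] := left_limit_comp Dg Eth th_le t0'.
  apply: (D_absorbing0 Dg El) (v0 (left_limit_unique hv h0)).
  rewrite leNgt; apply/negP => /sup[u [_ ut]].
  by rewrite ltNge th_le// ltW.
Qed.

(** * Time changes of the half-line and the extended clock *)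

(** A monotone surjection has no jumps: preimages of f x - e and f x + e enclose a neighbourhood of
    x. *)
Lemma increasing_surjective_continuous (R : realType) (f : R -> R) :
  (forall x y : R, (0 <= x)%R -> (x < y)%R -> (f x < f y)%R) ->
  (forall y : R, (0 <= y)%R -> exists2 x : R, (0 <= x)%R & f x = y) ->
  (forall x : R, (0 <= x)%R -> (0 <= f x)%R) ->
  {within `[0%R, +oo[, continuous f}.
Proof.
move=> f_lt f_surj f_ge0; apply/subspace_continuousP => x /=.
rewrite in_itv/= andbT => x0; apply/cvgrPdist_lt => e e0.
have f_le u v : (0 <= u)%R -> (u <= v)%R -> (f u <= f v)%R.
  by move=> u0; rewrite le_eqVlt => /predU1P[->//|uv]; exact/ltW/f_lt.
have [|y2 y20 fy2] := f_surj (f x + e)%R; first by rewrite addr_ge0 ?f_ge0// ltW.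
have xy2 : (x < y2)%R.
  by rewrite ltNge; apply/negP => /(f_le _ _ y20); rewrite fy2; lra.
have [y1 y1x fy1] : exists2 y1, (y1 < x)%R &
    forall z, (0 <= z)%R -> (y1 < z)%R -> (f x - e < f z)%R.
  have [xe|xe] := leP e (f x).
    have [|y1 y10 fy1] := f_surj (f x - e)%R; first by rewrite subr_ge0.
    exists y1; last by move=> z _ /(f_lt _ _ y10); rewrite fy1.
    by rewrite ltNge; apply/negP => /(f_le _ _ x0); rewrite fy1; lra.
  (* Here f x - e is negative while f is nonnegative, so any bound below x serves. *)
  exists (x - 1)%R; first lra.
  by move=> z /f_ge0; lra.
have xin : x \in `]y1, y2[ by rewrite in_itv/= y1x.
rewrite near_withinE; apply: filterS (near_in_itvoo xin) => z.
rewrite /= in_itv/= => /andP[yz zy]; rewrite in_itv/= andbT => z0.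
rewrite distrC ltr_distl fy1//= -fy2; exact: f_lt.
Qed.

(** Continuity in both directions follows from strict monotonicity and surjectivity; time changes
    are built and used below through these order conditions. *)
Lemma increasing_homeoP (R : realType) (f : R -> R) : increasing_homeo f <->
  [/\ forall x y : R, (0 <= x)%R -> (x < y)%R -> (f x < f y)%R,
      forall y : R, (0 <= y)%R -> exists2 x : R, (0 <= x)%R & f x = y &
      forall x : R, (0 <= x)%R -> (0 <= f x)%R].
Proof.
have I (x : R) : (x \in `[0%R, +oo[) = (0 <= x)%R by rewrite in_itv/= andbT.
split => [[f_lt [h [f0 h0 fK hK _]]]|[f_lt f_surj f_ge0]].
  have ge0 x : (0 <= x)%R -> (0 <= f x)%R by rewrite -!I; exact: f0.
  split => // [x y x0 xy|y y0].
    by apply: f_lt => //; rewrite I// (le_trans x0)// ltW.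
  by exists (h y); [rewrite -I; apply: h0; rewrite /= I|rewrite hK// I].
have [h hP] : {h : R -> R & forall y, (0 <= y)%R -> (0 <= h y)%R /\ f (h y) = y}.
  apply: (@choice _ _ (fun y x => (0 <= y)%R -> (0 <= x)%R /\ f x = y)) => y.
  have [y0|y0] := pselect (0 <= y)%R; last by exists 0%R.
  by have [x x0 fx] := f_surj y y0; exists x.
have f_le u v : (0 <= u)%R -> (u <= v)%R -> (f u <= f v)%R.
  by move=> u0; rewrite le_eqVlt => /predU1P[->//|uv]; exact/ltW/f_lt.
have f_inj u v : (0 <= u)%R -> (0 <= v)%R -> f u = f v -> u = v.
  move=> u0 v0 fuv; have [uv|vu|//] := ltgtP u v.
    by have := f_lt _ _ u0 uv; rewrite fuv ltxx.
  by have := f_lt _ _ v0 vu; rewrite fuv ltxx.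
split; first by move=> x y; rewrite I => x0 _; exact: f_lt.
exists h; split.
- by move=> x /=; rewrite !I; exact: f_ge0.
- by move=> x /=; rewrite !I => /hP[].
- by move=> x; rewrite I => x0; have [? ?] := hP _ (f_ge0 _ x0); exact: f_inj.
- by move=> x; rewrite I => /hP[].
split; first exact: increasing_surjective_continuous.
apply: increasing_surjective_continuous.
- move=> x y x0 xy; have y0 := le_trans x0 (ltW xy).
  have [hx fx] := hP x x0; have [hy fy] := hP y y0.
  by rewrite ltNge; apply/negP => /(f_le _ _ hy); rewrite fx fy leNgt xy.
- by move=> y y0; exists (f y); [exact: f_ge0|have [? ?] := hP _ (f_ge0 _ y0); exact: f_inj].
- by move=> y /hP[].
Qed.

(** From [s] on [g] is 0 and 1/g is infinite, hence above the slope A / (t - s) for every A. *)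
Lemma clock_pinfty (R : realType) (g : \bar R -> \bar R) (s t : R) :
  D g -> (0 <= s)%R -> (s < t)%R -> g s%:E = 0 -> clock g t%:E = +oo.
Proof.
move=> Dg s0 st gs; apply: eq_infty => A.
have [A0|A0] := leP A 0%R.
  by apply: le_trans (clock_ge0 _ Dg); rewrite lee_fin.
have ts : (0 < t - s)%R by rewrite subr_gt0.
apply: le_trans (@clock_lower_bound R g s t (A / (t - s)) Dg s0 (ltW st) _ _).
- by rewrite divfK ?gt_eqF// leeDr// clock_ge0.
- by rewrite divr_ge0// ltW.
- move=> u su _; rewrite (D_absorbing0 Dg _ _ gs) ?inve0 ?leey//.
  by rewrite lee_fin ltW.
Qed.

(** A real-valued version that can be a bijection of the half-line even if the clock of [g] is
    bounded or explodes after [b]; [fine] loses nothing when the clock is finite at [b]. *)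
Definition extended_clock (R : realType) (g : \bar R -> \bar R) (b t : R) : R :=
  (fine (clock g (Num.min t b)%:E) + (t - Num.min t b))%R.

Lemma extended_clock_le (R : realType) (g : \bar R -> \bar R) (b t : R) :
  D g -> clock g b%:E < +oo -> (t <= b)%R ->
  (extended_clock g b t)%:E = clock g t%:E.
Proof.
move=> Dg fin tb; rewrite /extended_clock min_l// subrr addr0 fineK//.
rewrite ge0_fin_numE ?clock_ge0//; apply: le_lt_trans fin; exact: clock_le.
Qed.

Lemma extended_clock_ge (R : realType) (g : \bar R -> \bar R) (b t : R) :
  (b <= t)%R -> extended_clock g b t = (extended_clock g b b + (t - b))%R.
Proof. by move=> bt; rewrite /extended_clock min_r// minxx subrr addr0. Qed.

(** Strict growth before [b] comes from [g] being finite there. Surjectivity is an intermediate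
    value argument resting on the one-sided continuity of the clock. *)
Lemma extended_clock_homeo (R : realType) (g : \bar R -> \bar R) (b : R) :
  D g -> (0 <= b)%R -> clock g b%:E < +oo ->
  (forall s : R, (0 <= s)%R -> (s < b)%R -> g s%:E != +oo) ->
  increasing_homeo (extended_clock g b).
Proof.
move=> Dg b0 fin gy.
have Kle t : (t <= b)%R -> (extended_clock g b t)%:E = clock g t%:E.
  exact: extended_clock_le.
have Kge := @extended_clock_ge R g b.
have finle t : (t <= b)%R -> clock g t%:E < +oo.
  by move=> tb; apply: le_lt_trans fin; exact: clock_le.
have Klt s t : (0 <= s)%R -> (s < t)%R -> (t <= b)%R ->
    (extended_clock g b s < extended_clock g b t)%R.
  move=> s0 st tb; have sb := lt_le_trans st tb.
  rewrite -lte_fin !Kle ?(ltW sb)//; apply: clock_lt => //; first exact: gy.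
  exact/finle/ltW.
apply/increasing_homeoP; split.
- move=> s t s0 st; have [tb|bt] := leP t b; first exact: Klt.
  rewrite (Kge t (ltW bt)); have [sb|bs] := ltP s b.
    by have := Klt _ _ s0 sb (lexx b); lra.
  by rewrite (Kge s bs); lra.
- move=> y y0; have [Ky|yK] := leP (extended_clock g b b) y.
    exists (b + (y - extended_clock g b b))%R; first lra.
    by rewrite Kge; lra.
  (* The preimage of a level y below the value at [b] is the last time at which the clock is at most
     y. *)
  pose S := [set t | (0 <= t)%R /\ (t <= b)%R /\ clock g t%:E <= y%:E].
  have S0 : S 0%R by split=> //; split => //; rewrite clock0 lee_fin.
  have supS : has_sup S by split; [exists 0%R|exists b => t [_ []]].
  pose u := sup S.
  have u0 : (0 <= u)%R by exact: (ub_le_sup supS.2).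
  have ub : (u <= b)%R by apply: ge_sup; [exists 0%R|move=> t [_ []]].
  exists u => //; apply/EFin_inj; rewrite Kle//; apply/eqP; rewrite eq_le.
  apply/andP; split.
    (* If the clock exceeded y at u, it would already do so at some w < u, and w would bound S. *)
    rewrite leNgt; apply/negP => yu.
    have up : 0 < u%:E.
      rewrite lte_fin lt_neqAle u0 andbT; apply/eqP => u00; move: yu.
      by rewrite -u00 clock0 lte_fin ltNge y0.
    have [w [w0 wu yw]] := clock_left_continuous Dg up yu.
    suff : (u <= w)%R by rewrite leNgt -lte_fin wu.
    apply: ge_sup; first by exists 0%R.
    move=> t [_ [_ ty]]; rewrite leNgt; apply/negP => wt.
    have : clock g w%:E <= clock g t%:E by apply: clock_le => //; rewrite lee_fin ltW.
    by move=> /le_trans/(_ ty); rewrite leNgt yw.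
  (* If the clock is below y at u, then u < b, and [g u] is not 0 since the clock is finite at [b];
     the linear bound after u then puts a later time in S. *)
  rewrite leNgt; apply/negP => uy.
  have ub' : (u < b)%R.
    rewrite lt_neqAle ub andbT; apply/eqP => ubE.
    by move: uy yK; rewrite ubE -lte_fin Kle// => /lt_trans h/h; rewrite ltxx.
  have gu : g u%:E != 0.
    by apply/eqP => gu; move: fin; rewrite (clock_pinfty Dg u0 ub' gu) ltxx.
  have [e e0 [c c0 H]] := clock_right_finite Dg u0 gu.
  have cu : clock g u%:E \is a fin_num by rewrite ge0_fin_numE ?clock_ge0// finle.
  have ycu : (0 < y - fine (clock g u%:E))%R by rewrite subr_gt0 -lte_fin fineK.
  have c1 : (0 < c + 1)%R by lra.
  (* The three terms keep u + d in the range of the linear bound, in [0, b], and with c d at most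
     the remaining gap; c + 1 avoids a zero divisor. *)
  pose d := (Num.min (Num.min e (b - u)) ((y - fine (clock g u%:E)) / (c + 1)))%R.
  have d0 : (0 < d)%R by rewrite !lt_min e0 subr_gt0 ub' divr_gt0.
  have de : (d <= e)%R by rewrite !ge_min lexx.
  have db : (d <= b - u)%R by rewrite !ge_min lexx orbT.
  have dc : (d * (c + 1) <= y - fine (clock g u%:E))%R.
    by rewrite -ler_pdivlMr// ge_min lexx orbT.
  suff : (u + d <= u)%R by lra.
  apply: (ub_le_sup supS.2); split; first lra.
  split; first lra.
  apply: le_trans (H _ _ _) _; [lra|lra|].
  rewrite -(fineK cu) -EFinD lee_fin.
  have -> : (u + d - u = d)%R by ring.
  by nra.
- move=> t t0; have [tb|bt] := leP t b.
    by rewrite -lee_fin Kle// clock_ge0.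
  rewrite (Kge t (ltW bt)).
  have : (0 <= extended_clock g b b)%R by rewrite -lee_fin Kle// clock_ge0.
  lra.
Qed.

(** * Comparing the clocks of two close paths *)

(** The supremum of the times in ]-oo, b] satisfying P satisfies P by the left step, and cannot be
    below b by the right step. *)
Lemma real_induction (R : realType) (b : R) (P : R -> Prop) : (0 <= b)%R ->
  (forall s t, (s <= t)%R -> P t -> P s) -> P 0%R ->
  (forall s, (0 <= s)%R -> (s < b)%R -> P s -> exists2 t, (s < t)%R & P t) ->
  (forall s, (0 < s)%R -> (s <= b)%R ->
    (forall t, (0 <= t)%R -> (t < s)%R -> P t) -> P s) -> P b.
Proof.
move=> b0 Pmono P0 Pright Pleft.
pose S := [set t | (t <= b)%R /\ P t].
have S0 : S 0%R by [].
have supS : has_sup S by split; [exists 0%R|exists b => t []].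
pose u := sup S.
have u0 : (0 <= u)%R by exact: (ub_le_sup supS.2).
have ub : (u <= b)%R by apply: ge_sup; [exists 0%R|move=> t []].
have Pu : P u.
  have [un0|u00] := ltP 0%R u; last by apply: Pmono P0.
  apply: Pleft => // t _ tu.
  have ut0 : (0 < u - t)%R by rewrite subr_gt0.
  have [w Sw tw] := sup_adherent ut0 supS.
  by apply: Pmono (Sw.2); move: tw; rewrite -/u subKr => /ltW.
have [ub'|bu] := ltP u b; last by apply: Pmono Pu.
have [t ut Pt] := Pright _ u0 ub' Pu.
have : (Num.min t b <= u)%R.
  apply: (ub_le_sup supS.2); split; first by rewrite ge_min lexx orbT.
  by apply: Pmono Pt; rewrite ge_min lexx.
by rewrite leNgt lt_min ut ub'.
Qed.

Lemma metric_ball_sub (R : realType) (rho : \bar R -> \bar R -> R) x U :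
  compatible_on_E rho -> E x -> nbhs x U ->
  exists2 r : R, (0 < r)%R & forall y, E y -> (rho x y < r)%R -> U y.
Proof.
move=> rho_compat Ex xU; apply/(rho_compat x U Ex).
by rewrite /within/=; apply: filterS xU.
Qed.

Lemma nbhs_metric_ball (R : realType) (rho : \bar R -> \bar R -> R) x (r : R) :
  compatible_on_E rho -> E x -> (0 < r)%R ->
  nbhs x [set y | E y -> (rho x y < r)%R].
Proof.
move=> rho_compat Ex r0.
by apply/(rho_compat x [set y | (rho x y < r)%R] Ex); exists r.
Qed.

(** The pointwise content of [d_infty rho g y < d] for d at most 1, witnessed by [lam]. *)
Definition lam_close (R : realType) (rho : \bar R -> \bar R -> R) (d : R)
    (g y : \bar R -> \bar R) (lam : R -> R) :=
  (forall s, E s -> (rho (g s) (y (extend lam s)) < d)%R) /\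
  (forall s : R, (0 <= s)%R -> (`|lam s - s| < d)%R).

Lemma lam_close_le (R : realType) (rho : \bar R -> \bar R -> R) (d d' : R) g y lam :
  (d <= d')%R -> lam_close rho d g y lam -> lam_close rho d' g y lam.
Proof.
by move=> dd' [h1 h2]; split => [s /h1|s /h2] /lt_le_trans; apply.
Qed.

Lemma D_E (R : realType) (g : \bar R -> \bar R) (s : R) :
  D g -> (0 <= s)%R -> E (g s%:E).
Proof. by move=> Dg s0; apply: (D_range Dg); rewrite /E/= lee_fin. Qed.

(** Between [s] and [t] both 1/g and, after the time change, 1/y lie in [c1, c2]. The increments
    differ by (c2 - c1)(t - s) for this oscillation, plus 2 d c2 because lam t - lam s and t - s
    differ by at most 2 d. *)
Lemma clock_compare_step (R : realType) (rho : \bar R -> \bar R -> R)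
    (g y : \bar R -> \bar R) (lam : R -> R) (s t d r c1 c2 A : R) (a : \bar R) :
  metric_on_E rho -> D g -> D y -> increasing_homeo lam ->
  lam_close rho d g y lam -> (0 <= s)%R -> (s <= t)%R -> E a -> (0 <= c1)%R ->
  (forall z, E z -> (rho a z < r)%R -> c1%:E <= z^-1 <= c2%:E) ->
  (forall u : R, (s <= u)%R -> (u < t)%R -> (rho a (g u%:E) < r / 2)%R) ->
  (d <= r / 2)%R -> (0 < r)%R -> clock g s%:E < +oo ->
  clock y (lam s)%:E <= clock g s%:E + A%:E ->
  clock g s%:E <= clock y (lam s)%:E + A%:E ->
  let B := (A + (c2 - c1) * (t - s) + 2 * d * c2)%R in
  clock y (lam t)%:E <= clock g t%:E + B%:E /\
  clock g t%:E <= clock y (lam t)%:E + B%:E.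
Proof.
move=> [rho_ge0 rho0 rhoC rho_tri] Dg Dy hlam [cl1 cl2] s0 st Ea c10 hr gr dr r0 fin h1 h2 B.
have /increasing_homeoP[lam_lt lam_surj lam_ge0] := hlam.
have t0 := le_trans s0 st.
have rhoaa : rho a a = 0%R by apply/(rho0 _ _ Ea Ea).
have c12 : (c1 <= c2)%R.
  have /andP[k1 k2] := hr a Ea (ltac:(rewrite rhoaa//)).
  by rewrite -lee_fin; exact: le_trans k2.
have c20 := le_trans c10 c12.
have lam_le : (lam s <= lam t)%R.
  by move: st; rewrite le_eqVlt => /predU1P[->//|/(lam_lt _ _ s0)/ltW].
have gin u : (s < u)%R -> (u < t)%R -> c1%:E <= (g u%:E)^-1 <= c2%:E.
  move=> su ut; apply: hr; first by apply: D_E => //; exact: le_trans (ltW su).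
  by apply: lt_trans (gr _ (ltW su) ut) _; lra.
(* Every u here is lam w with w in ]s, t[, so y u is within d of g w and hence within r of a. *)
have yin u : (lam s < u)%R -> (u < lam t)%R -> c1%:E <= (y u%:E)^-1 <= c2%:E.
  move=> su ut; have u0 : (0 <= u)%R by apply: le_trans (ltW su); exact: lam_ge0.
  have [w w0 lw] := lam_surj u u0.
  have sw : (s < w)%R.
    rewrite ltNge; apply/negP; rewrite le_eqVlt => /predU1P[ws|/(lam_lt _ _ w0)]; last lra.
    by move: su; rewrite -lw ws ltxx.
  have wt : (w < t)%R.
    rewrite ltNge; apply/negP; rewrite le_eqVlt => /predU1P[ws|/(lam_lt _ _ t0)]; last lra.
    by move: ut; rewrite -lw ws ltxx.
  have Eyu := D_E Dy u0; have Egw := D_E Dg w0.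
  apply: hr => //; apply: le_lt_trans (rho_tri _ _ _ Ea Egw Eyu) _.
  have := gr _ (ltW sw) wt; have := cl1 w%:E (ltac:(rewrite /E/= lee_fin//)).
  by rewrite /= lw; lra.
have gU := clock_upper_bound Dg s0 st (fun u su ut => (andP (gin u su ut)).2).
have gL := clock_lower_bound Dg s0 st c10 (fun u su ut => (andP (gin u su ut)).1).
have ls0 := lam_ge0 _ s0.
have yU := clock_upper_bound Dy ls0 lam_le (fun u su ut => (andP (yin u su ut)).2).
have yL := clock_lower_bound Dy ls0 lam_le c10 (fun u su ut => (andP (yin u su ut)).1).
have := clock_ge0 s%:E Dg; have := clock_ge0 t%:E Dg.
have := clock_ge0 (lam s)%:E Dy; have := clock_ge0 (lam t)%:E Dy.
have := cl2 _ s0; have := cl2 _ t0; rewrite !ltr_norml => /andP[lt1 lt2] /andP[ls1 ls2].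
have m1 : (c2 * (lam t - lam s) <= c2 * (t - s + 2 * d))%R by apply: ler_wpM2l => //; lra.
have m2 : (c1 * (t - s - 2 * d) <= c1 * (lam t - lam s))%R by apply: ler_wpM2l => //; lra.
have d0 : (0 <= d)%R by lra.
have m3 : (d * c1 <= d * c2)%R by apply: ler_wpM2l.
move: fin h1 h2 gU gL yU yL.
case: (clock g s%:E) => [gs| |] //; case: (clock g t%:E) => [gt| |] //;
case: (clock y (lam s)%:E) => [ys| |] //; case: (clock y (lam t)%:E) => [yt| |] //.
rewrite -!EFinD !lee_fin => _ h1 h2 gU gL yU yL _ _ _ _.
by rewrite /B; split; lra.
Qed.

Lemma increasing_homeo0 (R : realType) (f : R -> R) : increasing_homeo f -> f 0%R = 0%R.
Proof.
move=> /increasing_homeoP[f_lt f_surj f_ge0]; have [x x0 fx] := f_surj 0%R (lexx _).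
apply/eqP; rewrite eq_le f_ge0// andbT -[leRHS]fx.
by move: x0; rewrite [in X in X -> _]le_eqVlt => /predU1P[<- //|x0]; exact/ltW/f_lt.
Qed.

Lemma clock_compare (R : realType) (rho : \bar R -> \bar R -> R)
    (g : \bar R -> \bar R) (b eps : R) :
  metric_on_E rho -> compatible_on_E rho -> D g -> (0 <= b)%R ->
  (forall s : R, (0 <= s)%R -> (s < b)%R -> g s%:E != 0) ->
  (forall (s : R) v, (0 < s)%R -> (s <= b)%R -> left_limit g s%:E v -> v != 0) ->
  (0 < eps)%R -> clock g b%:E < +oo /\
  exists2 d : R, (0 < d)%R & forall y lam, D y -> increasing_homeo lam ->
    lam_close rho d g y lam -> forall s : R, (0 <= s)%R -> (s <= b)%R ->
    clock y (lam s)%:E <= clock g s%:E + eps%:E /\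
    clock g s%:E <= clock y (lam s)%:E + eps%:E.
Proof.
move=> rho_metric rho_compat Dg b0 gn0 gl0 eps0.
(* Makes e s at most eps/2 for s <= b; the + 1 keeps the divisor positive. *)
pose e := (eps / (2 * (b + 1)))%R.
have e0 : (0 < e)%R by rewrite divr_gt0// mulr_gt0//; lra.
(* The oscillations of 1/g, at most e on each piece, accumulate into e s. As eta is arbitrary, it
   can be halved on the earlier pieces to leave room for the error 2 d c2 of a new one. *)
pose P (t : R) := clock g t%:E < +oo /\ forall eta : R, (0 < eta)%R ->
  exists2 d : R, (0 < d)%R & forall y lam, D y -> increasing_homeo lam ->
    lam_close rho d g y lam -> forall s : R, (0 <= s)%R -> (s <= t)%R ->
    clock y (lam s)%:E <= clock g s%:E + (e * s + eta)%:E /\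
    clock g s%:E <= clock y (lam s)%:E + (e * s + eta)%:E.
have glue (s t : R) a (r c1 c2 : R) : (0 <= s)%R -> (s <= t)%R -> E a -> (0 < r)%R ->
    (0 <= c1)%R -> (c1 <= c2)%R -> (c2 - c1 <= e)%R ->
    (forall z, E z -> (rho a z < r)%R -> c1%:E <= z^-1 <= c2%:E) ->
    (forall u : R, (s <= u)%R -> (u < t)%R -> (rho a (g u%:E) < r / 2)%R) ->
    P s -> P t.
  move=> s0 st Ea r0 c10 c12 ce hr gr [fin Hs]; split.
    apply: le_lt_trans (_ : clock g s%:E + (c2 * (t - s))%:E < _).
      apply: clock_upper_bound => // u su ut.
      have [] := andP (hr (g u%:E) _ _) => //.
        by apply: D_E => //; exact: le_trans (ltW su).
      by apply: lt_trans (gr _ (ltW su) ut) _; lra.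
    exact: lte_add_pinfty fin (ltry _).
  move=> eta eta0; have [|d d0 Hd] := Hs (eta / 2)%R; first by rewrite divr_gt0.
  have c21 : (0 < c2 + 1)%R by lra.
  (* The terms serve the bound up to s, the stay of y in the r-ball, and 2 d' c2 <= eta/2. *)
  pose d' := (Num.min (Num.min d (r / 2)) (eta / (4 * (c2 + 1))))%R.
  have d'0 : (0 < d')%R by rewrite !lt_min d0 !divr_gt0// mulr_gt0.
  have d'd : (d' <= d)%R by rewrite !ge_min lexx.
  have d'r : (d' <= r / 2)%R by rewrite !ge_min lexx orbT.
  have d'c : (d' * (4 * (c2 + 1)) <= eta)%R.
    by rewrite -ler_pdivlMr ?mulr_gt0// ge_min lexx orbT.
  exists d' => // y lam Dy hlam cl w w0 wt.
  have Hd' := Hd y lam Dy hlam (lam_close_le d'd cl).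
  have [ws|sw] := leP w s.
    have [h1 h2] := Hd' w w0 ws.
    by split; [apply: le_trans h1 _|apply: le_trans h2 _];
      rewrite leeD2l// lee_fin lerD2l; lra.
  have [h1 h2] := Hd' s s0 (lexx s).
  have [|k1 k2] := clock_compare_step rho_metric Dg Dy hlam cl s0 (ltW sw) Ea c10 hr _ d'r r0 fin h1 h2.
    by move=> u su uw; apply: gr => //; exact: lt_le_trans uw wt.
  have B : (e * s + eta / 2 + (c2 - c1) * (w - s) + 2 * d' * c2 <= e * w + eta)%R.
    have : ((c2 - c1) * (w - s) <= e * (w - s))%R.
      by apply: ler_wpM2r => //; rewrite subr_ge0 ltW.
    lra.
  by split; [apply: le_trans k1 _|apply: le_trans k2 _]; rewrite leeD2l// lee_fin.
have [] : P b.
  apply: real_induction => //.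
  - move=> s t st [fin H]; split.
      by apply: le_lt_trans fin; apply: clock_le.
    move=> eta /H[d d0 Hd]; exists d => // y lam Dy hlam cl w w0 ws.
    by apply: Hd => //; exact: le_trans st.
  - split; first by rewrite clock0 ltry.
    move=> eta eta0; exists 1%R => // y lam Dy hlam _ s s0 s00.
    have -> : s = 0%R by apply/eqP; rewrite eq_le s0 s00.
    by rewrite increasing_homeo0// !clock0 mulr0 !add0r lee_fin ltW.
  (* Right step: just after s, [g] stays near [g s], which is not 0. *)
  - move=> s s0 sb Ps.
    have Egs := D_E Dg s0; have gs0 := gn0 s s0 sb.
    have [c1 [c2 [c10 c12 ce N]]] := nbhs_inve Egs gs0 e0.
    have [r r0 hr] := metric_ball_sub rho_compat Egs N.
    have r20 : (0 < r / 2)%R by rewrite divr_gt0.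
    have [d d0 Hd] := D_right_continuous Dg s0 (nbhs_metric_ball rho_compat Egs r20).
    exists (s + d)%R; first lra.
    apply: (glue s (s + d)%R (g s%:E) r c1 c2) => //; first lra.
    by move=> u su ud; apply: Hd => //; apply: D_E => //; exact: le_trans su.
  (* Left step: just before s, [g] stays near its nonzero left limit; the piece starts at an earlier
     time, where P is known. *)
  - move=> s s0 sb Pt.
    have sp : 0 < s%:E by rewrite lte_fin.
    have [v [Ev hv _ _]] := D_left_limit Dg sp.
    have [c1 [c2 [c10 c12 ce N]]] := nbhs_inve Ev (gl0 s v s0 sb hv) e0.
    have [r r0 hr] := metric_ball_sub rho_compat Ev N.
    have r20 : (0 < r / 2)%R by rewrite divr_gt0.
    have [a [a0 as_] Ha] := hv _ (nbhs_metric_ball rho_compat Ev r20).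
    rewrite lte_fin in as_.
    apply: (glue a s v r c1 c2) => //; first exact: ltW; last exact: Pt.
    by move=> u au us; apply: Ha => //; apply: D_E => //; exact: le_trans au.
move=> fin H; split => //.
have [|d d0 Hd] := H (eps / 2)%R; first by rewrite divr_gt0.
exists d => // y lam Dy hlam cl s s0 sb.
have [h1 h2] := Hd y lam Dy hlam cl s s0 sb.
have es : (e * s + eps / 2 <= eps)%R.
  have : (e * (b + 1) = eps / 2)%R by rewrite /e; field; lra.
  have : (e * s <= e * (b + 1))%R by apply: ler_wpM2l; [exact: ltW|lra].
  lra.
by split; [apply: le_trans h1 _|apply: le_trans h2 _]; rewrite leeD2l// lee_fin.
Qed.

(** * The cutoff time *)

(** Minimality of [t0] drives the proof: absorption at 0 before [t0], or a left limit at [t0] equal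
    to [g +oo], would make an earlier time eligible. *)
Lemma D_cutoff (R : realType) (rho : \bar R -> \bar R -> R) (g : \bar R -> \bar R) (e : R) :
  metric_on_E rho -> compatible_on_E rho -> D g -> (0 < e)%R ->
  exists t0 : R, [/\ (0 <= t0)%R,
    forall u, E u -> t0%:E <= u -> (rho (g u) (g +oo%E) <= e)%R,
    forall s : R, (0 <= s)%R -> (s < t0)%R -> g s%:E != 0,
    forall (s : R) v, (0 < s)%R -> (s <= t0)%R -> left_limit g s%:E v -> v != 0 &
    exists2 r : R, (0 < r)%R & forall s : R, (0 <= s)%R -> (s < t0)%R ->
      exists s' : R, [/\ (s <= s')%R, (s' <= t0)%R & (r <= rho (g s'%:E) +oo%E)%R]].
Proof.
move=> [rho_ge0 rho0 rhoC rho_tri] rho_compat Dg e0; set a := g +oo.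
have Eoo : E (+oo : \bar R) by rewrite /E/= leey.
have Ea : E a by exact: (D_range Dg).
have rhoaa x : E x -> rho x x = 0%R by move=> Ex; apply/(rho0 _ _ Ex Ex).
pose A := [set t : R | (0 <= t)%R /\ forall u, E u -> t%:E <= u -> (rho (g u) a <= e)%R].
have Anbhs (s t : R) : (0 <= s)%R ->
    (forall u : R, (s <= u)%R -> (u < t)%R -> (rho a (g u%:E) < e)%R) ->
    (forall u, E u -> t%:E <= u -> (rho (g u) a <= e)%R) -> A s.
  move=> s0 h1 h2; split => // u Eu su; have [tu|ut] := leP t%:E u; first exact: h2.
  case: u Eu su ut => [u| |//] Eu; rewrite ?lee_fin ?lte_fin => su ut.
    by rewrite rhoC//; [exact/ltW/h1|exact: (D_range Dg)].
  by move: ut; rewrite ltNge leey.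
have [b Ab] : A !=set0.
  have /left_limit_pinfty h := D_limit Dg.
  have [b [b0 _] hb] := h _ (nbhs_metric_ball rho_compat Ea e0).
  exists b; split => // u Eu bu; rewrite rhoC//; last exact: (D_range Dg).
  case: u Eu bu => [u| |//] Eu bu; last by rewrite rhoaa// ltW.
  by apply/ltW/hb; rewrite ?ltry//; exact: (D_range Dg).
have infA : has_inf A by split; [exists b|exists 0%R => t []].
pose t0 := inf A.
have t00 : (0 <= t0)%R by apply: lb_le_inf => //; [exists b|move=> t []].
(* The infimum is attained, because [g t0] is the limit from the right of values e-close to
   [g +oo]. *)
have At0 : A t0.
  split => // u Eu t0u.
  have gtP v : E v -> t0%:E < v -> (rho (g v) a <= e)%R.
    case: v => [v| |//] Ev; last by rewrite -/a rhoaa// ltW.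
    rewrite lte_fin => tv; have vt : (0 < v - t0)%R by rewrite subr_gt0.
    have [w [w0 Aw] wv] := inf_adherent vt infA.
    by apply: Aw => //; rewrite lee_fin; move: wv; rewrite -/t0 addrC subrK => /ltW.
  move: t0u; rewrite le_eqVlt => /predU1P[<-|]; last exact: gtP.
  rewrite leNgt; apply/negP => lt_e.
  have Egt := D_E Dg t00.
  have re : (0 < rho (g t0%:E) a - e)%R by rewrite subr_gt0.
  have [d d0 Hd] := D_right_continuous Dg t00 (nbhs_metric_ball rho_compat Egt re).
  have td0 : (0 <= t0 + d / 2)%R by lra.
  have Egd := D_E Dg td0.
  have := Hd (t0 + d / 2)%R (ltac:(lra)) (ltac:(lra)) Egd.
  have := gtP (t0 + d / 2)%:E (ltac:(rewrite /E/= lee_fin//)) (ltac:(rewrite lte_fin; lra)).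
  by have := rho_tri _ _ _ Egt Egd Ea; lra.
have t0_le s : A s -> (t0 <= s)%R by move=> As; apply: ge_inf => //; exact: infA.2.
have cst (s : R) : (0 <= s)%R -> (forall u, s%:E <= u -> g u = a) -> (t0 <= s)%R.
  by move=> s0 h; apply: t0_le; split => // u Eu /h ->; rewrite rhoaa// ltW.
have left_a v : (0 < t0)%R -> left_limit g t0%:E v -> v <> a.
  move=> tp hv va; rewrite va in hv.
  have [s [s0 st] hs] := hv _ (nbhs_metric_ball rho_compat Ea e0).
  rewrite lte_fin in st; suff : (t0 <= s)%R by rewrite leNgt st.
  apply: t0_le; apply: (Anbhs s t0) => //; last exact: At0.2.
  by move=> u su ut; apply: hs => //; apply: D_E => //; exact: le_trans su.
have Es (s : R) : (0 <= s)%R -> E s%:E by move=> s0; rewrite /E/= lee_fin.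
have no0 (s : R) : (0 <= s)%R -> (s < t0)%R -> g s%:E != 0.
  move=> s0 st; apply/eqP => gs; move: st; rewrite ltNge => /negP; apply.
  apply: cst => // u su; rewrite (D_absorbing0 Dg (Es _ s0) su gs).
  by rewrite /a (D_absorbing0 Dg (Es _ s0) (leey _) gs).
exists t0; split => //; first exact: At0.2.
  move=> s v s0 st hv; apply/eqP => v0.
  have sp : 0 < s%:E by rewrite lte_fin.
  have [w [_ hw w0 _]] := D_left_limit Dg sp.
  have gs : g s%:E = 0 by apply: w0; rewrite -v0; exact: left_limit_unique hw hv.
  move: st; rewrite le_eqVlt => /predU1P[st|st]; last first.
    by have := no0 _ (ltW s0) st; rewrite gs eqxx.
  (* At [t0] a left limit 0 gives [g t0 = 0], hence [g +oo = 0], which [left_a] excludes as a left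
     limit. *)
  rewrite st in s0 hv gs; apply: (left_a v) => //.
  by rewrite v0 /a (D_absorbing0 Dg (Es _ t00) (leey _) gs).
have [tp|tn] := ltP 0%R t0; last first.
  (* No s satisfies 0 <= s < t0, so any positive r serves. *)
  by exists 1%R => // s s0 st; have := lt_le_trans st tn; rewrite ltNge s0.
have pos x : E x -> x <> +oo -> (0 < rho x +oo%E)%R.
  by move=> Ex xn; rewrite lt_neqAle rho_ge0// andbT eq_sym; apply/eqP => /(rho0 _ _ Ex Eoo).
have Egt := D_E Dg t00.
(* If [g t0] is finite, s' = t0 works. Otherwise [g +oo = +oo], so the left limit v at [t0] is not
   [+oo]; s' is then taken just before [t0], where [g] is within half the distance from v to
   [+oo]. *)
have [gty|gty] := pselect (g t0%:E = +oo); last first.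
  exists (rho (g t0%:E) +oo); first exact: pos.
  by move=> s s0 st; exists t0; split => //; exact: ltW.
have ay : a = +oo by rewrite /a (D_absorbingy Dg (Es _ t00) (leey _) gty).
have tp' : 0 < t0%:E by rewrite lte_fin.
have [v [Ev hv _ _]] := D_left_limit Dg tp'.
have vy : v <> +oo by rewrite -ay; exact: left_a.
have r0 : (0 < rho v +oo%E / 2)%R by rewrite divr_gt0// pos.
exists (rho v +oo%E / 2)%R => // s s0 st.
have [w [w0 wt] hw] := hv _ (nbhs_metric_ball rho_compat Ev r0).
rewrite lte_fin in wt.
exists (Num.max s w); have mt : (Num.max s w < t0)%R by rewrite gt_max st.
have m0 : (0 <= Num.max s w)%R by rewrite le_max s0.
split; [by rewrite le_max lexx|exact: ltW|].
have Egm := D_E Dg m0.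
have := hw (Num.max s w) (ltac:(rewrite le_max lexx orbT//)) (ltac:(rewrite lte_fin//)) Egm.
by have := rho_tri _ _ _ Ev Egm Eoo; lra.
Qed.

(** * Operations on time changes, and bounds on [d_infty] *)

Lemma increasing_homeo_comp (R : realType) (f h : R -> R) :
  increasing_homeo f -> increasing_homeo h -> increasing_homeo (f \o h).
Proof.
move=> /increasing_homeoP[f_lt f_surj f_ge0] /increasing_homeoP[h_lt h_surj h_ge0].
apply/increasing_homeoP; split => [x y x0 xy|y y0|x x0] /=.
- by apply: f_lt; [exact: h_ge0|exact: h_lt].
- by have [z z0 fz] := f_surj y y0; have [x x0 hx] := h_surj z z0; exists x; rewrite // hx.
- exact/f_ge0/h_ge0.
Qed.

Lemma increasing_homeo_inv (R : realType) (f : R -> R) : increasing_homeo f ->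
  exists2 h : R -> R, increasing_homeo h & forall x, (0 <= x)%R -> f (h x) = x.
Proof.
have I (x : R) : (x \in `[0%R, +oo[) = (0 <= x)%R by rewrite in_itv/= andbT.
move=> hf; have /increasing_homeoP[f_lt _ f_ge0] := hf.
have [_ [h [_ h0 fK hK _]]] := hf.
exists h; last by move=> x x0; rewrite hK// I.
have h_ge0 x : (0 <= x)%R -> (0 <= h x)%R by rewrite -!I; exact: h0.
apply/increasing_homeoP; split => // [x y x0 xy|y y0]; last first.
  by exists (f y); [exact: f_ge0|rewrite fK// I].
have y0 := le_trans x0 (ltW xy).
rewrite ltNge; apply/negP; rewrite le_eqVlt => /predU1P[e|/(f_lt _ _ (h_ge0 _ y0))].
  by move: xy; rewrite -(hK x) ?I// -(hK y) ?I// e ltxx.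
by rewrite !hK ?I// ltNge ltW.
Qed.

Lemma right_inv_ge (R : realType) (k : \bar R -> \bar R) (t u : \bar R) :
  (forall s t, s <= t -> k s <= k t) -> k u <= t -> u <= right_inv k t.
Proof.
move=> k_le kut; rewrite leNgt; apply/negP => /(right_inv_lt k_le).
by rewrite ltNge kut.
Qed.

(** As [g t] is not [+oo], the clock increases strictly right after [t], so its level at [t] is
    exceeded at once. *)
Lemma right_inv_clock (R : realType) (g : \bar R -> \bar R) (t : R) :
  D g -> (0 <= t)%R -> g t%:E != +oo -> clock g t%:E < +oo ->
  right_inv (clock g) (clock g t%:E) = t%:E.
Proof.
move=> Dg t0 gt fin; have kle := fun s t => @clock_le R g s t Dg.
apply/eqP; rewrite eq_le right_inv_ge// andbT; apply/lee_addgt0Pr => e e0.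
apply: right_inv_le; first by rewrite /E/= -EFinD lee_fin; lra.
by rewrite -EFinD; apply: clock_lt => //; lra.
Qed.

(** With d at most 1, the truncation in [d_infty] cannot produce the bound, so some time change
    does. *)
Lemma d_infty_lt (R : realType) (rho : \bar R -> \bar R -> R) (g y : \bar R -> \bar R) (d : R) :
  (d <= 1)%R -> d_infty rho g y < d%:E ->
  exists2 lam, increasing_homeo lam & lam_close rho d g y lam.
Proof.
move=> d1; rewrite /d_infty gt_min => /orP[|/ereal_inf_lt[_ [lam hlam <-]]].
  by rewrite lte_fin ltNge d1.
rewrite gt_max => /andP[h1 h2]; exists lam => //; split => s s0; rewrite -lte_fin.
  by apply: le_lt_trans h1; apply: ereal_sup_ubound; exists s.
by apply: le_lt_trans h2; apply: ereal_sup_ubound; exists s; rewrite //= in_itv/= s0.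
Qed.

Lemma d_infty_le (R : realType) (rho : \bar R -> \bar R -> R) (g y : \bar R -> \bar R)
    (lam : R -> R) (d : R) : increasing_homeo lam ->
  (forall s, E s -> (rho (g s) (y (extend lam s)) <= d)%R) ->
  (forall s : R, (0 <= s)%R -> (`|lam s - s| <= d)%R) ->
  d_infty rho g y <= d%:E.
Proof.
move=> hlam h1 h2; rewrite /d_infty ge_min; apply/orP; right.
apply: le_trans (ereal_inf_lbound _) _; first by exists lam.
rewrite ge_max; apply/andP; split; apply: ge_ereal_sup => _ [s s0 <-]; rewrite lee_fin.
  exact: h1.
by apply: h2; move: s0; rewrite /= in_itv/= andbT.
Qed.

(** * Closeness of the inverse transforms of two close paths *)

Section lamperti_inv_close.
Context (R : realType) (rho : \bar R -> \bar R -> R) (g y : \bar R -> \bar R).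
Context (lam : R -> R) (t0 e d r : R).
Context (rho_metric : metric_on_E rho).
Context (Dg : D g) (Dy : D y) (hlam : increasing_homeo lam).
Context (gy_close : lam_close rho d g y lam).
Context (t00 : (0 <= t0)%R) (de : (d <= e)%R) (dr : (d <= r)%R).
Context (g_tail : forall u, E u -> t0%:E <= u -> (rho (g u) (g +oo%E) <= e)%R).
Context (g_below_pinfty : forall s : R, (0 <= s)%R -> (s < t0)%R ->
  exists s' : R, [/\ (s <= s')%R, (s' <= t0)%R & (r <= rho (g s'%:E) +oo%E)%R]).
Context (g_fin : clock g t0%:E < +oo).
Context (gy_clock : forall s : R, (0 <= s)%R -> (s <= t0)%R ->
  clock y (lam s)%:E <= clock g s%:E + e%:E /\
  clock g s%:E <= clock y (lam s)%:E + e%:E).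

Let Es (s : R) : (0 <= s)%R -> E s%:E.
Proof. by move=> s0; rewrite /E/= lee_fin. Qed.

Let Eoo : E (+oo : \bar R).
Proof. by rewrite /E/= leey. Qed.

Let lam_ge0 (s : R) : (0 <= s)%R -> (0 <= lam s)%R.
Proof. by case/increasing_homeoP: hlam => _ _; apply. Qed.

Let lam_lt (s t : R) : (0 <= s)%R -> (s < t)%R -> (lam s < lam t)%R.
Proof. by case/increasing_homeoP: hlam => + _ _; apply. Qed.

Let lam_le (s t : R) : (0 <= s)%R -> (s <= t)%R -> (lam s <= lam t)%R.
Proof. by move=> s0; rewrite le_eqVlt => /predU1P[->//|/(lam_lt s0)/ltW]. Qed.

Let gNy (s : R) : (0 <= s)%R -> (s < t0)%R -> g s%:E != +oo.
Proof.
move=> s0 st; have [s' [ss' s't]] := g_below_pinfty s0 st; apply: contraTneq => gs.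
rewrite -ltNge (D_absorbingy Dg (Es s0) _ gs) ?lee_fin//.
case: rho_metric => rho_ge0 rho0 _ _.
have -> : rho +oo +oo = 0%R by apply/(rho0 _ _ Eoo Eoo).
(* Positivity of r comes from closeness at infinity: 0 <= rho < d <= r. *)
have [h _] := gy_close; apply: lt_le_trans dr; apply: le_lt_trans (h _ Eoo).
by apply: rho_ge0; apply: D_range.
Qed.

(** If y were [+oo] at lam s, it would be [+oo] at lam s' too, putting [g s'] at distance less than
    r from [+oo]. *)
Let yNy (s : R) : (0 <= s)%R -> (s < t0)%R -> y (lam s)%:E != +oo.
Proof.
move=> s0 st; have [s' [ss' s't]] := g_below_pinfty s0 st; apply: contraTneq => ys.
have s'0 := le_trans s0 ss'; have [h _] := gy_close.
have := h _ (Es s'0); rewrite /= (D_absorbingy Dy (Es (lam_ge0 s0)) _ ys).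
  by rewrite -ltNge => /lt_le_trans; apply.
by rewrite lee_fin lam_le.
Qed.

Let y_fin : clock y (lam t0)%:E < +oo.
Proof.
apply: le_lt_trans (gy_clock t00 (lexx _)).1 _.
by rewrite lte_add_pinfty// ltry.
Qed.

Let K := extended_clock g t0.
Let Ky := extended_clock y (lam t0).

Let K_below (t : R) : (t <= t0)%R -> (K t)%:E = clock g t%:E.
Proof. exact: extended_clock_le. Qed.

Let Ky_below (t : R) : (0 <= t)%R -> (t <= t0)%R ->
  (Ky (lam t))%:E = clock y (lam t)%:E.
Proof. by move=> ? ?; apply: extended_clock_le => //; exact: lam_le. Qed.

Let K_homeo : increasing_homeo K.
Proof. exact: extended_clock_homeo. Qed.

Let Ky_homeo : increasing_homeo Ky.
Proof.
apply: extended_clock_homeo => //; first exact: lam_ge0.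
move=> u u0 ut; have [_ lam_surj _] := (increasing_homeoP lam).1 hlam.
have [s s0 ls] := lam_surj u u0; rewrite -ls; apply: yNy => //.
by rewrite ltNge; apply/negP => /(lam_le t00); rewrite ls leNgt ut.
Qed.

(** Up to [t0] the clocks differ by at most e. Afterwards both run with slope 1, and the
    displacements of [lam] at [t] and at [t0] add at most e each. *)
Let time_close (t : R) : (0 <= t)%R -> (`|Ky (lam t) - K t| <= 3 * e)%R.
Proof.
have below s : (0 <= s)%R -> (s <= t0)%R -> (`|Ky (lam s) - K s| <= e)%R.
  move=> s0 st; have := gy_clock s0 st.
  rewrite -K_below// -Ky_below//.
  by rewrite -!EFinD !lee_fin ler_norml => -[? ?]; apply/andP; split; lra.
have [_ h] := gy_close.
have e0 : (0 <= e)%R by apply: le_trans (normr_ge0 _) (below _ t00 (lexx _)).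
move=> t_ge0; have [tt0|t0t] := leP t t0.
  by apply: le_trans (below _ t_ge0 tt0) _; lra.
have := below _ t00 (lexx _); have := h _ t00; have := h _ t_ge0.
have KE : K t = (K t0 + (t - t0))%R by apply: extended_clock_ge; exact: ltW.
have KyE : Ky (lam t) = (Ky (lam t0) + (lam t - lam t0))%R.
  by apply: extended_clock_ge; apply: lam_le => //; exact: ltW.
rewrite KE KyE !ltr_norml !ler_norml => /andP[b1 b2] /andP[b3 b4] /andP[b5 b6].
by have de' := de; apply/andP; split; lra.
Qed.

(** After [t0] the three errors are from g u to [g +oo], from there to g w', and from g w' to y at
    lam w'. *)
Let value_close (t : R) : (0 <= t)%R ->
  (rho (lamperti_inv g (K t)%:E) (lamperti_inv y (Ky (lam t))%:E) <= 3 * e)%R.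
Proof.
move=> t_ge0; have [h _] := gy_close; have de' := de.
have [rho_ge0 rho0 rhoC rho_tri] := rho_metric.
have e0 : (0 <= e)%R.
  by apply: le_trans (g_tail Eoo (leey _)); apply: rho_ge0; apply: D_range.
(* The case t = t0 goes with the tail: [g t0] may be [+oo], where [right_inv_clock] does not
   apply. *)
have [tt0|t0t] := ltP t t0; rewrite /lamperti_inv /= -!/(clock _).
  rewrite K_below ?(ltW tt0)// Ky_below ?(ltW tt0)//.
  have lt0 : (lam t)%:E <= (lam t0)%:E by rewrite lee_fin lam_le// ltW.
  rewrite !right_inv_clock//; try exact: gNy; try exact: yNy; try exact: lam_ge0.
  - by apply: le_trans (ltW (h _ (Es t_ge0))) _; lra.
  - by apply: le_lt_trans y_fin; exact: clock_le.
  - by apply: le_lt_trans g_fin; apply: clock_le => //; rewrite lee_fin ltW.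
have kgle := fun s t => @clock_le R g s t Dg.
have kyle := fun s t => @clock_le R y s t Dy.
have t0_theta : t0%:E <= right_inv (clock g) (K t)%:E.
  apply: right_inv_ge => //; rewrite -K_below// lee_fin.
  by rewrite /K (extended_clock_ge _ t0t); lra.
have lt0_theta : (lam t0)%:E <= right_inv (clock y) (Ky (lam t))%:E.
  apply: right_inv_ge => //; rewrite -Ky_below// lee_fin.
  rewrite /Ky (extended_clock_ge y (lam_le t00 t0t)).
  by have := lam_le t00 t0t; lra.
set u := right_inv (clock g) _ in t0_theta *.
set w := right_inv (clock y) _ in lt0_theta *.
have Eu : E u by exact: right_inv_ge0.
have Ew : E w by exact: right_inv_ge0.
(* The time w of y is pulled back through [lam], so that y at w compares with g at w', which lies in
   the tail. *)
have [w' [Ew' t0w' <-]] : exists w', [/\ E w', t0%:E <= w' & extend lam w' = w].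
  case: w Ew lt0_theta => [x| |//] Ew lt0_theta; last by exists +oo; rewrite leey.
  have [_ lam_surj _] := (increasing_homeoP lam).1 hlam.
  rewrite /E/= lee_fin in Ew; have [x' x'0 lx] := lam_surj x Ew.
  exists x'%:E; split; [exact: Es| |by rewrite /= lx].
  rewrite lee_fin leNgt; apply/negP => /(lam_lt x'0).
  by rewrite lx ltNge -lee_fin lt0_theta.
have Eg v : E v -> E (g v) by move=> Ev; apply: D_range.
have Eyw : E (y (extend lam w')).
  apply: D_range => //; case: w' Ew' {t0w'} => [x| |//] //.
  by rewrite /E/= !lee_fin; exact: lam_ge0.
have := h _ Ew'; have := g_tail Eu t0_theta; have := g_tail Ew' t0w'.
have := rho_tri _ _ _ (Eg _ Eu) (Eg _ Eoo) Eyw.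
have := rho_tri _ _ _ (Eg _ Eoo) (Eg _ Ew') Eyw.
by rewrite (rhoC (g +oo%E) (g w')); [lra|exact: Eg|exact: Eg].
Qed.

Lemma d_infty_lamperti_inv_le :
  d_infty rho (lamperti_inv g) (lamperti_inv y) <= (3 * e)%:E.
Proof.
have [Ki Ki_homeo KKi] := increasing_homeo_inv K_homeo.
have Ki_ge0 (s : R) : (0 <= s)%R -> (0 <= Ki s)%R.
  by case/increasing_homeoP: Ki_homeo => _ _; apply.
apply: (@d_infty_le _ _ _ _ (Ky \o (lam \o Ki))).
- exact/increasing_homeo_comp/increasing_homeo_comp.
- case=> [s| |//] Esr; last first.
    have [rho_ge0 _ _ _] := rho_metric; have [h _] := gy_close; have de' := de.
    rewrite /lamperti_inv /= !right_inv_pinfty.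
    have := h _ Eoo; have := rho_ge0 _ _ (D_range Dg Eoo) (D_range Dy Eoo).
    by rewrite /=; lra.
  rewrite /E/= lee_fin in Esr.
  by have := value_close (Ki_ge0 _ Esr); rewrite KKi.
- by move=> s s0; have := time_close (Ki_ge0 _ s0); rewrite KKi.
Qed.

End lamperti_inv_close.

Theorem proposition5 (R : realType) (rho : \bar R -> \bar R -> R)
    (rho_metric : metric_on_E rho) (rho_compat : compatible_on_E rho) :
  (forall g : \bar R -> \bar R, D g -> D (lamperti_inv g)) /\
  continuous_on_metric (@D R) (d_infty rho) (@lamperti_inv R).
Proof.
split; first exact: D_lamperti_inv.
(* Times and values will differ by at most 3 e / 4, strictly below e. *)
move=> g Dg e e0; have e40 : (0 < e / 4)%R by rewrite divr_gt0.
have [t0 [t00 tail gn0 gl0 [r r0 gfin]]] := D_cutoff rho_metric rho_compat Dg e40.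
have [fin [d d0 Hd]] := clock_compare rho_metric rho_compat Dg t00 gn0 gl0 e40.
(* The terms 1, d, e/4 and r serve, in order, [d_infty_lt], the clock comparison, and the two bounds
   on d in [d_infty_lamperti_inv_le]. *)
pose d' := (Num.min (Num.min 1 d) (Num.min (e / 4) r))%R.
have d'0 : (0 < d')%R by rewrite !lt_min ltr01 d0 e40 r0.
exists d' => // y Dy gy.
have [|lam hlam cl] := d_infty_lt _ gy; first by rewrite !ge_min lexx.
have d'd : (d' <= d)%R by rewrite !ge_min lexx orbT.
apply: le_lt_trans (d_infty_lamperti_inv_le rho_metric Dg Dy hlam cl t00 _ _ tail gfin fin _) _.
- by rewrite !ge_min lexx !orbT.
- by rewrite !ge_min lexx !orbT.
- exact: Hd y lam Dy hlam (lam_close_le d'd cl).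
- by rewrite lte_fin; lra.
Qed.
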